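(* Consider the two-layer system with layer-wise (dynamic) event-triggered inter-layer communication described in the context, with event rules $$t_{0_x}=0,\quad t_{k_x+1}=\inf\Big\{t>t_{k_x}:\ \|e_x(t)\|^2\ge \frac{c_2(\eta(t)+\Omega)}{\beta\|P_zG\|^2+\sigma_1c_2}\Big\},$$ $$t_{0_z}=0,\quad t_{k_z+1}=\inf\Big\{t>t_{k_z}:\ \|e_z(t)\|^2\ge \frac{c_1(\nu(t)+\mu)}{\beta\|P_xK\|^2+\sigma_2c_1}\Big\},$$ and internal variables satisfying $\dot\eta=-\eta+\sigma_1\|e_x\|^2$, $\eta(0)=\eta_0\ge0$, and $\dot\nu=-\nu+\sigma_2\|e_z\|^2$, $\nu(0)=\nu_0\ge0$. Assume that along the trajectory the state derivatives are bounded: $\|\dot x(t)\|\le M_x$ and $\|\dot z(t)\|\le M_z$ for some constants $M_x,M_z>0$. Then neither event sequence exhibits Zeno behavior, and both layers have a positive minimum inter-event time: (a) the minimum inter-event time $\tau_x=\inf_{k_x}(t_{k_x+1}-t_{k_x})$ of the physical layer satisfies $$\tau_x\ \ge\ \frac{1}{2M_x}\sqrt{\frac{c_2\,\Omega}{\beta\|P_zG\|^2+\sigma_1c_2}}\ >0;$$ (b) the minimum inter-event time $\tau_z=\inf_{k_z}(t_{k_z+1}-t_{k_z})$ of the auxiliary layer satisfies $$\tau_z\ \ge\ \frac{1}{2M_z}\sqrt{\frac{c_1\,\mu}{\beta\|P_xK\|^2+\sigma_2c_1}}\ >0 .$$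
   Context: Setting. $N$ follower agents with states $x=(x_1,\dots,x_N)^\top\in\mathbb R^N$ (physical layer) and $N$ virtual agents with states $z=(z_1,\dots,z_N)^\top\in\mathbb R^N$ (auxiliary layer); $x_0\in\mathbb R$ is the constant leader state. $\pmb 1_N$ is the all-ones vector. $\|\cdot\|$ is the Euclidean norm for vectors and the Frobenius norm for matrices; $\lambda_{\min}$ is the smallest eigenvalue of a symmetric matrix. Matrices. $A=-(\mathcal L_x+\mathcal B)$, where $\mathcal L_x$ is the Laplacian of an undirected connected graph on the $N$ followers and $\mathcal B=\mathrm{diag}\{b_i\}$ with $b_i\in\{0,1\}$ and at least one $b_i=1$ (so $A$ is Hurwitz); $B=\mathcal B\pmb 1_N$. $H,K,G\in\mathbb R^{N\times N}$ are Hurwitz (hence invertible), and $\beta>0$ is the inter-layer gain. $P_x,P_z$ are symmetric positive definite matrices such that $Q_x:=-(P_xA+A^\top P_x)$ and $Q_z:=-(P_zH+H^\top P_z)$ are positive definite. Moreover $K^\top P_x=P_zG$ and $D=G\pmb 1_N$. Dynamics. $\dot x=Ax+\beta K\bar z+Bx_0+d(x,t)$ and $\dot z=Hz-\beta G\bar x+\beta Dx_0$, where $\bar x(t)=x(t_{k_x})$ for $t\in[t_{k_x},t_{k_x+1})$ and $\bar z(t)=z(t_{k_z})$ for $t\in[t_{k_z},t_{k_z+1})$ are the last transmitted states ($k_x,k_z=0,1,2,\dots$ index the events in the physical and auxiliary layers respectively; a next event time is $+\infty$ if the set in its definition is empty). Sampling errors: $e_x=x-\bar x$, $e_z=z-\bar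 z$, which are reset to $0$ at the respective event times. Zeno behavior means infinitely many events in a finite time interval. Attack. $d(x,t)\in\mathbb R^N$ is an unknown attack signal satisfying $\|d(x,t)\|\le\bar D$ for all $t\ge0$, where $\bar D>0$ is a known constant. Design parameters. $c_1,c_2,c_3>0$ with $c_3+c_1\beta<\lambda_{\min}(Q_x)$ and $c_2\beta<\lambda_{\min}(Q_z)$; $\sigma_1,\sigma_2>0$; $\mu>0$; and $\Omega=\varepsilon-\frac{\|P_x\|^2}{c_3}\bar D^2>0$, where $\varepsilon>0$ is a constant with $\varepsilon>\frac{\|P_x\|^2}{c_3}\bar D^2$. *)

(* Defs.v *)
From mathcomp Require Export all_boot all_order all_algebra complex.
From mathcomp Require Export all_classical all_reals all_analysis.
Export Order.TTheory GRing.Theory Num.Theory numFieldNormedType.Exports.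

Set Implicit Arguments.
Unset Strict Implicit.
Unset Printing Implicit Defensive.

#[export] Set Implicit Arguments.
#[export] Unset Strict Implicit.
#[export] Unset Printing Implicit Defensive.

Local Open Scope classical_set_scope.
Local Open Scope ring_scope.

(* The library norm on ['M[R]_(m, n)] is the maximum norm. The Frobenius norm
   of a column vector is its Euclidean norm, so [fnorm] serves for both. *)
Definition fnorm (R : realType) (m n : nat) (A : 'M[R]_(m, n)) : R :=
  Num.sqrt (\sum_i \sum_j A i j ^+ 2).

Definition laplacian (R : realType) (N : nat) (e : rel 'I_N) : 'M[R]_N :=
  \matrix_(i, j) (if i == j then #|[pred k | e i k]|%:R else - (e i j)%:R).

Definition hurwitz (R : realType) (N : nat) (M : 'M[R]_N) : Prop :=
  forall l : R[i], eigenvalue (map_mx (real_complex R) M) l -> complex.Re l < 0.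

Definition posdefmx (R : realType) (N : nat) (P : 'M[R]_N) : Prop :=
  P^T = P /\ forall v : 'cV[R]_N, v != 0 -> 0 < (v^T *m P *m v) ord0 ord0.

(* Meant for symmetric [Q] of positive size: the set of eigenvalues is then
   finite and nonempty, and the infimum is a minimum. *)
Definition lambda_min (R : realType) (N : nat) (Q : 'M[R]_N) : R :=
  inf [set l : R | eigenvalue Q l].

Definition abs_continuous (R : realType) (V : normedModType R)
    (a b : R) (f : R -> V) : Prop :=
  forall eps : R, 0 < eps -> exists2 delta : R, 0 < delta &
  forall (n : nat) (u v : 'I_n -> R),
    (forall i, [/\ a <= u i, u i <= v i & v i <= b]) ->
    trivIset setT (fun i => [set t : R | u i < t < v i]) ->
    \sum_i (v i - u i) < delta ->
    \sum_i `|f (v i) - f (u i)| < eps.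

(* Event times are extended reals: [te k = +oo] means that the k-th event does
   not occur. A finite accumulation point of [te] is not excluded, so [te] need
   not cover the half-line: [covered te t] says that [t] lies in some
   [t_k, t_{k+1}), i.e. that the last transmission before [t] exists. *)
Definition covered (R : realType) (te : nat -> \bar R) (t : R) : Prop :=
  exists k, (te k <= t%:E < te k.+1)%E.

Definition is_hold (R : realType) (N : nat) (te : nat -> \bar R)
    (y ybar : R -> 'cV[R]_N) : Prop :=
  forall k (t : R), (te k <= t%:E < te k.+1)%E -> ybar t = y (fine (te k)).

(* In the rule giving t_{k+1} the sampling error is measured from the sample
   taken at t_k, before the reset at t_{k+1}. The infimum of the empty set is
   [+oo], and [te k = +oo] forces [te k.+1 = +oo]. *)
Definition event_rule (R : realType) (N : nat) (te : nat -> \bar R)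
    (y : R -> 'cV[R]_N) (threshold : R -> R) : Prop :=
  te 0%N = 0%E /\
  forall k, te k.+1 = ereal_inf (EFin @` [set t : R |
    (te k < t%:E)%E /\ threshold t <= fnorm (y t - y (fine (te k))) ^+ 2]).

Definition zeno (R : realType) (te : nat -> \bar R) : Prop :=
  exists a b : R, infinite_set [set k | (a%:E <= te k <= b%:E)%E].

Definition min_inter_event (R : realType) (te : nat -> \bar R) : \bar R :=
  ereal_inf [set (te k.+1 - te k)%E | k in [set k | te k \is a fin_num]].

(* Caratheodory solution of y' = F, imposed at the times in [dom]: right-hand
   sides jump at transmission instants, and the attack signal need not be
   continuous in time, so y' = F is required almost everywhere. *)
Definition solves_on (R : realType) (V : normedModType R) (dom : set R)
    (y F : R -> V) : Prop :=
  (forall T : R, 0 < T -> abs_continuous 0 T y) /\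
  {ae (@lebesgue_measure R), forall t, dom t -> is_derive t (1 : R) y (F t)}.

Definition derive_bounded_on (R : realType) (N : nat) (dom : set R)
    (y : R -> 'cV[R]_N) (M : R) : Prop :=
  {ae (@lebesgue_measure R),
    forall t, dom t -> fnorm (derive1 y t) <= M}.

(* Main.v *)
Require Import Defs.
From mathcomp Require Import measurable_realfun lra ring.

(* An absolutely continuous function whose derivative is a.e. bounded by [M] is
   [M]-Lipschitz, so between two consecutive events the sampling error grows by
   at most [M] times the elapsed time; at an event its square has reached the
   threshold, which is bounded below because the internal variable cannot
   become negative. Everything is known only while both layers have a last
   transmission, so accumulation of events is excluded by looking at the first
   time at which one of the layers has none: up to that time the gaps of both
   layers are bounded below, hence neither event sequence can stay below it. *)

Local Open Scope classical_set_scope.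
Local Open Scope ring_scope.

(** * Monotonicity of absolutely continuous functions *)

(** The supremum of the points satisfying [P] can be neither missed nor stopped at before [b]:
    [step] carries [P] across it from a point just to its left. This stands in for compactness of
    the segment. *)
Lemma segment_induction (R : realType) (P : R -> Prop) (a b : R) :
  a <= b -> P a ->
  (forall t, a <= t <= b -> exists2 dt : R, 0 < dt &
    forall s r, a <= s -> s <= t -> t <= r -> r <= b ->
      t - dt < s -> r < t + dt -> P s -> P r) ->
  P b.
Proof.
move=> ab Pa step.
pose S := [set t | a <= t <= b /\ P t].
have Sa : S a by split=> //; rewrite lexx ab.
have Sub : has_ubound S by exists b => t [/andP[]].
have Ssup : has_sup S by split=> //; exists a.
have aS : a <= sup S by exact: ub_le_sup.
have Sb : sup S <= b by apply: ge_sup => [|t [/andP[]] //]; exists a.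
have [dt dt0 Hdt] := step _ (introT andP (conj aS Sb)).
have [s [/andP[as_ sb] Ps] sS] := sup_adherent dt0 Ssup.
have sleS : s <= sup S by apply: ub_le_sup => //; split=> //; rewrite as_.
have reach r : sup S <= r -> r <= b -> r < sup S + dt -> P r.
  by move=> Sr rb rdt; exact: (Hdt s r).
have [bS|Sltb] := lerP b (sup S); first by apply: reach => //; lra.
(* If [sup S < b], this [r] lies beyond [sup S] yet within reach, which contradicts the supremum. *)
pose r := Num.min b (sup S + dt / 2).
have rb : r <= b by rewrite ge_min lexx.
have Sr : sup S < r by rewrite lt_min Sltb /=; lra.
have rdt : r < sup S + dt by rewrite gt_min; apply/orP; right; lra.
have : S r by split; [apply/andP; split; lra|apply: reach => //; lra].
by move/(ub_le_sup Sub); rewrite leNgt Sr.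
Qed.

Lemma abs_continuous_unif (R : realType) (V : normedModType R) (a b : R)
    (f : R -> V) (eps : R) : abs_continuous a b f -> 0 < eps ->
  exists2 dt : R, 0 < dt & forall s t, a <= s -> s <= t -> t <= b ->
    t - s < dt -> `|f t - f s| < eps.
Proof.
move=> ac /ac[dt dt0 H]; exists dt => // s t as_ st tb tsdt.
have := H 1%N (fun=> s) (fun=> t); rewrite !big_ord1; apply=> //.
by move=> i j _ _ _; rewrite (ord1 i) (ord1 j).
Qed.

Lemma abs_continuousW (R : realType) (V : normedModType R) (a b c d : R)
    (f : R -> V) :
  a <= c -> d <= b -> abs_continuous a b f -> abs_continuous c d f.
Proof.
move=> ac db H eps /H[dt dt0 {}H]; exists dt => // n u v uv.
apply: H => i; have [? ? ?] := uv i; split=> //; lra.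
Qed.

(* The interval [s, r] is only required to contain [t]: the increment is split
   at [t]. *)
Lemma is_derive_ge0_near (R : realType) (f : R -> R) (t l eps : R) :
  is_derive t 1 f l -> 0 <= l -> 0 < eps ->
  exists2 dt : R, 0 < dt & forall s r, s <= t -> t <= r ->
    t - dt < s -> r < t + dt -> f s - f r <= eps * (r - s).
Proof.
move=> [dft dfl] l0 e0.
have : h^-1 *: ((f \o shift t) (h *: (1:R)) - f t) @[h --> 0^'] --> l.
  by rewrite -dfl; exact: dft.
move=> /cvgrPdist_lt /(_ _ e0) /nbhs_ballP[dt /= dt0 H].
exists dt => // s r st tr sdt rdt.
have Hh h : `|h| < dt -> h != 0 -> `|l - h^-1 * (f (h + t) - f t)| < eps.
  move=> hdt h0; have := H h; rewrite /ball/= sub0r normrN => /(_ hdt h0).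
  by rewrite /GRing.scale/= mulr1.
(* On either side of [t] the difference quotient exceeds [l - eps], hence [- eps]. *)
have left_ : f s - f t <= eps * (t - s).
  have [->|sn] := eqVneq s t; first by rewrite !subrr mulr0.
  have sltt : s < t by rewrite lt_neqAle sn.
  have := Hh (s - t); rewrite subrK distrC ger0_norm ?subr_ge0// subr_eq0 sn.
  move=> /(_ ltac:(lra) isT); rewrite ltr_norml => /andP[_].
  set k := _^-1 * _ => kl.
  have -> : f s - f t = (s - t) * k by rewrite mulrA divff ?mul1r ?subr_eq0.
  nra.
have right_ : f t - f r <= eps * (r - t).
  have [->|rn] := eqVneq r t; first by rewrite !subrr mulr0.
  have tltr : t < r by rewrite lt_neqAle eq_sym rn.
  have := Hh (r - t); rewrite subrK ger0_norm ?subr_ge0// subr_eq0 rn.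
  move=> /(_ ltac:(lra) isT); rewrite ltr_norml => /andP[_].
  set k := _^-1 * _ => kl.
  have rk : f r - f t = (r - t) * k by rewrite mulrA divff ?mul1r ?subr_eq0.
  nra.
lra.
Qed.

(** The sum is the measure of a disjoint union contained in [U]. It lets a small measure of [U] meet
    the smallness condition of absolute continuity. *)
Lemma sum_itv_le_measure (R : realType) (n : nat) (u v : 'I_n -> R)
    (U : set R) : measurable U ->
  (forall i, u i <= v i) -> (forall i t, u i < t < v i -> U t) ->
  trivIset setT (fun i => [set t : R | u i < t < v i]) ->
  ((\sum_i (v i - u i))%:E <= lebesgue_measure U)%E.
Proof.
move=> mU uv inU triv.
have E i : [set t : R | u i < t < v i] = [set` `]u i, v i[].
  by apply/seteqP; split=> t /=; rewrite in_itv.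
have triv' : trivIset setT (fun i => [set` `]u i, v i[] : set R).
  by under eq_fun do rewrite -E.
have mI (i : 'I_n) : measurable ([set` `]u i, v i[] : set R).
  exact: measurable_itv.
rewrite -sumEFin.
under eq_bigr => i _.
  have -> : (v i - u i)%:E = lebesgue_measure ([set` `]u i, v i[] : set R).
    rewrite lebesgue_measure_itv/= lte_fin.
    case: ltP => // vu; have -> : v i = u i by apply/eqP; rewrite eq_le vu uv.
    by rewrite subrr.
  over.
rewrite -measure_bigsetU_ord//.
apply: le_measure => //; rewrite ?inE//.
  exact: bigsetU_measurable.
rewrite -bigcup_seq => t [i _] /=.
by rewrite in_itv/=; exact: inU.
Qed.

(** The new interval lies to the right of all the others. [unlift ord_max] sends the last index to
    [None], where [oapp] returns the new endpoint. *)
Lemma trivIset_itv_rcons (R : realType) (n : nat) (u v : 'I_n -> R) (s r : R) :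
  (forall i, v i <= s) ->
  trivIset setT (fun i => [set t : R | u i < t < v i]) ->
  trivIset setT (fun i : 'I_n.+1 =>
    [set t : R | oapp u s (unlift ord_max i) < t < oapp v r (unlift ord_max i)]).
Proof.
move=> vs triv i j _ _.
case: unliftP => [i' ->|->]; case: unliftP => [j' ->|->] //=.
- by move=> /(triv i' j' I I) ->.
- by move=> [t [/= /andP[_ tv] /andP[st _]]]; exfalso; have := vs i'; lra.
- by move=> [t [/= /andP[st _] /andP[_ tv]]]; exfalso; have := vs j'; lra.
Qed.

Lemma big_ord_rcons (R : realType) (n : nat) (F : option 'I_n -> R) :
  \sum_(i < n.+1) F (unlift ord_max i) = \sum_i F (Some i) + F None.
Proof.
rewrite big_ord_recr/= unlift_none; congr (_ + _); apply: eq_bigr => i _.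
have -> : widen_ord (leqnSn n) i = lift ord_max i.
  by apply: val_inj; rewrite /= /bump leqNgt ltn_ord.
by rewrite liftK.
Qed.

(* Cousin-style argument: cover the exceptional null set by an open [U] of
   small measure; subintervals with tag outside it lose at most [eps] times
   their length, and those inside [U] lose at most [eps] altogether by absolute
   continuity. *)
Lemma abs_continuous_derive_ge0 (R : realType) (f : R -> R) (a b : R) :
  a <= b -> abs_continuous a b f ->
  {ae (@lebesgue_measure R), forall t, a < t < b ->
     exists2 l, is_derive t (1 : R) f l & 0 <= l} ->
  f a <= f b.
Proof.
move=> ab ac [E [mE E0 notE]].
(* The term [eps * (b - a)] pays for tags outside [U], the extra [eps] for the intervals inside
   [U]. *)
suff loss eps : 0 < eps -> f a - f b <= eps * (b - a + 1).
  apply/ler_addgt0Pr => e e0.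
  have ba : 0 < b - a + 1 by lra.
  have := loss (e / (b - a + 1)) (divr_gt0 e0 ba).
  by rewrite divfK ?gt_eqF//; lra.
move=> eps0; have [dl dl0 acd] := ac _ eps0.
(* The derivative is known only on the open interval, so both endpoints join the exceptional set. *)
pose E' : set R := E `|` [set a; b].
have mE' : measurable E'.
  by apply: measurableU => //; apply: measurableU.
have E'0 : lebesgue_measure E' = 0%E.
  apply/negligibleP => //; apply: negligibleU; first exact/negligibleP.
  apply: negligibleU; apply/negligibleP => //; exact: lebesgue_measure_set1.
have [|U [oU E'U muU]] := lebesgue_regularity_outer mE' _ dl0.
  by rewrite [X in (X < _)%E]E'0.
have mU := open_measurable oU.
(* Outer regularity bounds the measure of the difference of [U] and [E']; since [E'] is null, this
   is the measure of [U]. *)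
have {}muU : (lebesgue_measure U < dl%:E)%E.
  have -> : lebesgue_measure U = lebesgue_measure (U `\` E').
    rewrite -[in LHS](setDUK E'U) measureU//.
    - by rewrite [X in (X + _)%E]E'0 add0e.
    - exact: measurableD.
    - by rewrite setDIK.
  exact: muU.
(* The invariant of the induction: the intervals collected so far lie in [U], so at [b] their total
   length is below [dl] and the last sum is below [eps]. *)
pose reach t := exists n (u v : 'I_n -> R),
  [/\ forall i, [/\ a <= u i, u i <= v i & v i <= t],
      trivIset setT (fun i => [set t : R | u i < t < v i]),
      forall i s, u i < s < v i -> U s &
      f a - f t <= eps * (t - a) + \sum_i `|f (v i) - f (u i)|].
suff [n [u [v [uv triv inU fab]]]] : reach b.
  have : \sum_i (v i - u i) < dl.
    rewrite -lte_fin; apply: le_lt_trans muU.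
    by apply: sum_itv_le_measure => // i; case: (uv i).
  by move=> /(acd _ _ _ uv triv); lra.
apply: (@segment_induction _ reach a b) => //.
  exists 0%N, (fun=> a), (fun=> a); split; try by case.
  by rewrite big_ord0; lra.
move=> t /andP[at_ tb].
(* For [t] in [U] the interval from [s] to [r] is appended to the family; otherwise the family is
   kept and the derivative at [t] bounds the loss. *)
have [Ut|nUt] := pselect (U t).
  have /nbhs_ballP[dt /= dt0 tU] : nbhs t U by exact: open_nbhs_nbhs.
  exists dt => // s r as_ st tr rb dts rdt [n [u [v [uv triv inU fas]]]].
  exists n.+1, (fun i => oapp u s (unlift ord_max i)),
    (fun i => oapp v r (unlift ord_max i)); split.
  - move=> i; case: unliftP => [j _|_] /=; last by split; lra.
    by have [? ? ?] := uv j; split; lra.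
  - by apply: trivIset_itv_rcons => // i; case: (uv i).
  - move=> i q; case: unliftP => [j _|_] /=; first exact: inU.
    by move=> /andP[sq qr]; apply: tU; rewrite /ball/= ltr_norml; lra.
  - rewrite (big_ord_rcons (fun o => `|f (oapp v r o) - f (oapp u s o)|))/=.
    have : f s - f r <= `|f r - f s| by rewrite distrC ler_norm.
    nra.
have tE' : ~ E' t by move=> /E'U.
have {}at_ : a < t.
  by rewrite lt_neqAle at_ andbT; apply/eqP => e; apply: tE'; right; left.
have {}tb : t < b.
  by rewrite lt_neqAle tb andbT; apply/eqP => e; apply: tE'; right; right.
have [l dl_ l0] : exists2 l, is_derive t (1 : R) f l & 0 <= l.
  apply: contrapT => H; apply: tE'; left; apply: notE => /= H'.
  by apply: H; apply: H'; rewrite at_.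
have [dt dt0 slope] := is_derive_ge0_near dl_ l0 eps0.
exists dt => // s r as_ st tr rb dts rdt [n [u [v [uv triv inU fas]]]].
exists n, u, v; split => //.
  by move=> i; have [? ? ?] := uv i; split; lra.
by have := slope s r st tr dts rdt; lra.
Qed.

(** * Frobenius norm and the Lipschitz bound *)

Lemma fnorm_sqr (R : realType) (m n : nat) (A : 'M[R]_(m, n)) :
  fnorm A ^+ 2 = \sum_i \sum_j A i j ^+ 2.
Proof.
by rewrite sqr_sqrtr//; do 2!apply: sumr_ge0 => ? _; exact: sqr_ge0.
Qed.

Lemma abs_continuous_dom (R : realType) (V W : normedModType R) (a b L C : R)
    (f : R -> V) (g : R -> W) :
  0 < L -> 0 < C -> abs_continuous a b g ->
  (forall s t, s <= t -> `|f t - f s| <= L * (t - s) + C * `|g t - g s|) ->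
  abs_continuous a b f.
Proof.
move=> L0 C0 acg fg eps eps0.
have C20 : 0 < 2 * C by rewrite mulr_gt0.
have [dt dt0 H] := acg _ (divr_gt0 eps0 C20).
(* The Lipschitz part and the part coming from [g] contribute less than [eps / 2] each. *)
exists (Num.min dt (eps / (2 * L))).
  by rewrite lt_min dt0 divr_gt0// mulr_gt0.
move=> n u v uv triv; rewrite lt_min => /andP[lendt lenL].
have : \sum_i `|f (v i) - f (u i)| <=
    L * (\sum_i (v i - u i)) + C * \sum_i `|g (v i) - g (u i)|.
  rewrite !mulr_sumr -big_split/=; apply: ler_sum => i _.
  by apply: fg; case: (uv i).
move/le_lt_trans; apply.
move: lenL (H _ _ _ uv triv lendt).
rewrite !ltr_pdivlMr ?mulr_gt0//.
set S1 := \sum_i _; set S2 := \sum_i _; nra.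
Qed.

Lemma coord_le_norm (R : realType) (m n : nat) (A : 'M[R]_(m, n)) i j :
  `|A i j| <= `|A|.
Proof.
by rewrite [leRHS]/Num.Def.normr/= mx_normrE; exact: (le_bigmax _ _ (i, j)).
Qed.

(** Summing the inequality [0 <= (M * v_i - p * w_i) ^+ 2] over [i] and dividing by [2 * p * M]
    gives the bound. *)
Lemma cauchy_schwarz_fnorm (R : realType) (N : nat) (v w : 'cV[R]_N) (p M : R) :
  0 < p -> 0 < M -> fnorm v <= p -> fnorm w <= M ->
  \sum_i v i ord0 * w i ord0 <= p * M.
Proof.
move=> p0 M0 vp wM.
have sqr (u : 'cV[R]_N) q : 0 < q -> fnorm u <= q ->
    \sum_i u i ord0 ^+ 2 <= q ^+ 2.
  move=> q0 uq; have -> : \sum_i u i ord0 ^+ 2 = fnorm u ^+ 2.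
    by rewrite fnorm_sqr; apply: eq_bigr => i _; rewrite big_ord1.
  by rewrite lerXn2r// ?nnegrE ?sqrtr_ge0// ltW.
have v2 := sqr v p p0 vp; have w2 := sqr w M M0 wM.
have : 2 * p * M * (\sum_i v i ord0 * w i ord0) <=
    M ^+ 2 * (\sum_i v i ord0 ^+ 2) + p ^+ 2 * \sum_i w i ord0 ^+ 2.
  rewrite !mulr_sumr -big_split/=; apply: ler_sum => i _.
  by have := sqr_ge0 (M * v i ord0 - p * w i ord0); nra.
have pM : 0 < 2 * p * M by rewrite !mulr_gt0.
move=> key; rewrite -(ler_pM2l pM); apply: (le_trans key).
have M2 : 0 <= M ^+ 2 by exact: sqr_ge0.
have p2 : 0 <= p ^+ 2 by exact: sqr_ge0.
have := ler_wpM2l M2 v2; have := ler_wpM2l p2 w2; nra.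
Qed.

(* The increment is tested against itself, which reduces the claim to the
   monotonicity of a scalar function. *)
Lemma abs_continuous_fnorm_le (R : realType) (N : nat) (y : R -> 'cV[R]_N)
    (a b M : R) : a <= b -> 0 < M -> abs_continuous a b y ->
  {ae (@lebesgue_measure R), forall t, a < t < b ->
     derivable y t 1 /\ fnorm (derive1 y t) <= M} ->
  fnorm (y b - y a) <= M * (b - a).
Proof.
move=> ab M0 acy dy; set w := y b - y a.
have [w0|wn0] := eqVneq (fnorm w) 0.
  by rewrite w0 mulr_ge0 ?subr_ge0// ltW.
have w0 : 0 < fnorm w by rewrite lt_neqAle eq_sym wn0 sqrtr_ge0.
(* By Cauchy-Schwarz [L] bounds the slope of [g], so [f] is nondecreasing. *)
set L := fnorm w * M; have L0 : 0 < L by exact: mulr_gt0.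
pose g t := \sum_i w i ord0 * y t i ord0.
pose f t := L * t - g t.
(* A Lipschitz constant of the pairing with [w] for the maximum norm; the added 1 makes it
   positive. *)
pose C := \sum_i `|w i ord0| + 1.
have C0 : 0 < C by apply: ltr_wpDl => //; apply: sumr_ge0.
have acf : abs_continuous a b (f : R -> R^o).
  apply: (@abs_continuous_dom _ _ _ _ _ L C _ y) => // s t st.
  rewrite (_ : f t - f s = L * (t - s) - \sum_i w i ord0 * (y t - y s) i ord0).
    apply: (le_trans (ler_normB _ _)); apply: lerD.
      by rewrite ger0_norm// mulr_ge0 ?subr_ge0// ltW.
    apply: (le_trans (ler_norm_sum _ _ _)).
    apply: (@le_trans _ _ ((\sum_i `|w i ord0|) * `|y t - y s|)).
      rewrite mulr_suml; apply: ler_sum => i _; rewrite normrM.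
      by apply: ler_wpM2l => //; exact: coord_le_norm.
    by apply: ler_wpM2r => //; rewrite lerDl.
  have -> : \sum_i w i ord0 * (y t - y s) i ord0 = g t - g s.
    by rewrite /g -sumrB; apply: eq_bigr => i _; rewrite !mxE mulrBr.
  by rewrite /f; ring.
have : f a <= f b.
  apply: (abs_continuous_derive_ge0 ab acf).
  move: dy; apply: filterS.
    exact: (ae_filter_ringOfSetsType (@lebesgue_measure R)).
  move=> t /[apply] -[dyt yM].
  exists (L - \sum_i w i ord0 * (derive1 y t) i ord0); last first.
    by rewrite subr_ge0; exact: cauchy_schwarz_fnorm.
  have dg : is_derive t (1 : R) (g : R -> R^o)
      (\sum_i w i ord0 * (derive1 y t) i ord0).
    have -> : g = \sum_i (w i ord0 \*: (fun t => y t i ord0 : R^o)).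
      by apply/funext => s; rewrite fct_sumE.
    apply: is_derive_sum => i; apply: is_deriveZ.
    rewrite derive1E derive_mx// mxE; apply: derivableP.
    exact: (derivable_mxP y t 1).1.
  have dL : is_derive t (1 : R) (fun s => L * s : R^o) L.
    have := is_deriveZ L (is_derive_id t (1 : R)).
    by rewrite [L *: _]mulr1.
  exact: is_deriveB.
have gw : g b - g a = fnorm w ^+ 2.
  rewrite fnorm_sqr /g -sumrB; apply: eq_bigr => i _.
  by rewrite big_ord1 -mulrBr expr2 !mxE.
rewrite /f => fab.
have : fnorm w * fnorm w <= fnorm w * (M * (b - a)).
  by rewrite -expr2 -gw; move: fab; rewrite /L; lra.
by rewrite ler_pM2l.
Qed.

(** * Right continuity and nonnegativity *)

Lemma abs_continuous_cvg_right (R : realType) (V : normedModType R)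
    (a b t0 : R) (f : R -> V) : abs_continuous a b f -> a <= t0 -> t0 < b ->
  f t @[t --> t0^'+] --> f t0.
Proof.
move=> ac at0 t0b; apply/cvgrPdist_lt => e e0.
have [dt dt0 H] := abs_continuous_unif ac e0.
near=> t.
have t0t : t0 < t by near: t; exact: nbhs_right_gt.
rewrite distrC; apply: H => //.
- by apply: ltW; near: t; exact: nbhs_right_lt.
- by rewrite ltrBlDl; near: t; apply: nbhs_right_lt; rewrite ltrDl.
Unshelve. all: by end_near. Qed.

(* Where [f < 0], [f] is nondecreasing, so it cannot have left [0, +oo[. *)
Lemma abs_continuous_ge0 (R : realType) (T : R) (f : R -> R) :
  0 <= T -> abs_continuous 0 T f -> 0 <= f 0 ->
  {ae (@lebesgue_measure R), forall t, 0 < t < T ->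
     exists2 l, is_derive t (1 : R) f l & - f t <= l} ->
  0 <= f T.
Proof.
move=> T0 ac f0 df; rewrite leNgt; apply/negP => fT.
pose S := [set t | 0 <= t <= T /\ 0 <= f t].
have S0 : S 0 by split=> //; rewrite lexx.
have Sub : has_ubound S by exists T => t [/andP[]].
have Ssup : has_sup S by split=> //; exists 0.
have S_ge0 : 0 <= sup S by exact: ub_le_sup.
have S_leT : sup S <= T by apply: ge_sup => [|t [/andP[]] //]; exists 0.
have [dt dt0 unif] := abs_continuous_unif ac (eps := - f T) ltac:(lra).
have dt2 : 0 < dt / 2 by lra.
have [s [/andP[s0 sT] fs] sS] := sup_adherent dt2 Ssup.
have sleS : s <= sup S by apply: ub_le_sup => //; split=> //; rewrite s0.
(* Beyond [sup S] the function is negative, hence nondecreasing, so [f r <= f T]. But [r] is within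
   [dt] of [s], where [f] is nonnegative, and such a drop is too large for [unif]. *)
pose r := Num.min T (sup S + dt / 2 / 2).
have rT : r <= T by rewrite ge_min lexx.
have Sr : sup S <= r by rewrite le_min S_leT/=; lra.
have rdt : r <= sup S + dt / 2 / 2 by rewrite ge_min lexx orbT.
have frT : f r <= f T.
  apply: abs_continuous_derive_ge0 => //.
    by apply: abs_continuousW ac => //; lra.
  move: df; apply: filterS.
    exact: (ae_filter_ringOfSetsType (@lebesgue_measure R)).
  move=> t H /andP[rt tT].
  have [|l dl fl] := H; first by apply/andP; split; lra.
  exists l => //; apply: le_trans fl; rewrite oppr_ge0 leNgt; apply/negP => ft.
  have : S t by split; [apply/andP; split|]; lra.
  by move/(ub_le_sup Sub); lra.
have := unif s r s0 (le_trans sleS Sr) rT ltac:(lra).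
by rewrite ltr_norml; lra.
Qed.

(** * Events and the gap estimate within one layer *)

Lemma cvg_fnorm_sqr (R : realType) (m n : nat) (F : set_system R)
    (f : R -> 'M[R]_(m, n)) (A : 'M[R]_(m, n)) : Filter F ->
  f t @[t --> F] --> A -> fnorm (f t) ^+ 2 @[t --> F] --> fnorm A ^+ 2.
Proof.
move=> FF fA; rewrite fnorm_sqr; under eq_fun do rewrite fnorm_sqr.
apply: cvg_big => [|i _]; first exact: add_continuous.
apply: cvg_big => [|j _]; first exact: add_continuous.
under eq_fun do rewrite expr2.
rewrite expr2.
have cf : f t i j @[t --> F] --> A i j.
  exact: (cvg_comp _ _ fA (@coord_continuous _ _ _ i j A)).
exact: cvgM.
Qed.

(* The threshold condition is closed, hence it holds at the infimum. *)
Lemma event_threshold (R : realType) (N : nat) (te : nat -> \bar R)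
    (y : R -> 'cV[R]_N) (thr : R -> R) (k : nat) (s t : R) :
  event_rule te y thr -> te k = s%:E -> te k.+1 = t%:E ->
  thr r @[r --> t^'+] --> thr t -> y r @[r --> t^'+] --> y t ->
  thr t <= fnorm (y t - y s) ^+ 2.
Proof.
move=> [_ /(_ k)] rule tek tek1 cthr cy; rewrite leNgt; apply/negP => lt.
pose phi r := thr r - fnorm (y r - y s) ^+ 2.
have cphi : phi r @[r --> t^'+] --> phi t.
  apply: cvgB => //; apply: cvg_fnorm_sqr.
  by apply: cvgB => //; exact: cvg_cst.
have phit : 0 < phi t by rewrite subr_gt0.
have /nbhs_ballP[dt /= dt0 near_t] : \forall r \near t^'+, 0 < phi r.
  exact: (cvgr_gt _ cphi).
(* With [phi] positive on the whole of [[t, t + dt)], no point of the triggering set lies below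
   [t + dt]. *)
have : ((t + dt)%:E <= te k.+1)%E.
  rewrite rule; apply: le_ereal_inf_tmp => _ [r [ter phir] <-].
  have tr : t <= r.
    rewrite -lee_fin -tek1 rule; apply: ereal_inf_lbound.
    by exists r.
  rewrite lee_fin leNgt; apply/negP => rdt.
  have : 0 < phi r.
    (* The filter [t^'+] says nothing at [t] itself, where positivity is [phit]. *)
    have [<-//|tr'] := eqVneq t r.
    apply: near_t; last by rewrite lt_neqAle tr'.
    by rewrite /ball/= distrC ltr_norml; lra.
  by move: phir; rewrite tek/= /phi; lra.
by rewrite tek1 lee_fin; lra.
Qed.

Lemma event_rule_le (R : realType) (N : nat) (te : nat -> \bar R)
    (y : R -> 'cV[R]_N) (thr : R -> R) (k : nat) :
  event_rule te y thr -> (te k <= te k.+1)%E.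
Proof.
move=> [_ ->]; apply: le_ereal_inf_tmp => _ [r [ter _] <-]; exact: ltW.
Qed.

(** Only times strictly before [t] must lie in [dom], so the bound still holds at a [t] not yet
    known to be covered. *)
Lemma solves_derive_bounded_fnorm_le (R : realType) (N : nat) (dom : set R)
    (y F : R -> 'cV[R]_N) (M s t : R) :
  0 < M -> solves_on dom y F -> derive_bounded_on dom y M ->
  0 <= s -> s <= t -> (forall r, 0 <= r < t -> dom r) ->
  fnorm (y t - y s) <= M * (t - s).
Proof.
move=> M0 [ac dy] yM s0 st below.
(* Absolute continuity is given on positive horizons only, and [t] may be 0. *)
have t1 : 0 < t + 1 by lra.
apply: abs_continuous_fnorm_le => //.
  by apply: abs_continuousW (ac _ t1) => //; lra.
move: dy yM; apply: filterS2.
  exact: (ae_filter_ringOfSetsType (@lebesgue_measure R)).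
move=> r dyr yMr /andP[sr rt].
have domr : dom r by apply: below; apply/andP; split; lra.
by split; [have [] := dyr domr|exact: yMr].
Qed.

(** The forcing term is nonnegative, so the derivative of [eta] is at least [- eta] almost
    everywhere. *)
Lemma internal_variable_ge0 (R : realType) (dom : set R) (eta w : R -> R)
    (sigma t : R) :
  0 <= sigma -> (forall r, 0 <= w r) ->
  solves_on dom (eta : R -> R^o) (fun r => - eta r + sigma * w r) ->
  0 <= eta 0 -> 0 <= t -> (forall r, 0 <= r < t -> dom r) -> 0 <= eta t.
Proof.
move=> sigma0 w0 [ac deta] eta0 t0 below.
have t1 : 0 < t + 1 by lra.
apply: abs_continuous_ge0 => //.
  by apply: abs_continuousW (ac _ t1) => //; lra.
move: deta; apply: filterS.
  exact: (ae_filter_ringOfSetsType (@lebesgue_measure R)).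
move=> r detar /andP[r0 rt].
exists (- eta r + sigma * w r); last by rewrite lerDl mulr_ge0.
by apply: detar; apply: below; apply/andP; split; lra.
Qed.

(** At [t] the squared error has reached the threshold, which is at least [c * w / W] because
    [eta t] is nonnegative; the Lipschitz bound converts this into elapsed time. The layer is
    generic, to serve both. *)
Lemma layer_gap (R : realType) (N : nat) (dom : set R) (te : nat -> \bar R)
    (y F ybar : R -> 'cV[R]_N) (eta : R -> R) (c w W M sigma : R)
    (k : nat) (s t : R) :
  0 < c -> 0 < w -> 0 < W -> 0 < M -> 0 <= sigma ->
  solves_on dom y F -> derive_bounded_on dom y M ->
  solves_on dom eta (fun r => - eta r + sigma * fnorm (y r - ybar r) ^+ 2) ->
  0 <= eta 0 ->
  event_rule te y (fun r => c * (eta r + w) / W) ->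
  te k = s%:E -> te k.+1 = t%:E -> 0 <= s ->
  (forall r, 0 <= r < t -> dom r) ->
  (2 * M)^-1 * Num.sqrt (c * w / W) <= t - s.
Proof.
move=> c0 w0 W0 M0 sigma0 ysol yM etasol eta0 rule tek tek1 s0 below.
have st : s <= t by rewrite -lee_fin -tek -tek1; exact: event_rule_le rule.
have t0 : 0 <= t by exact: le_trans st.
have t1 : 0 < t + 1 by lra.
have tt1 : t < t + 1 by lra.
have etat : 0 <= eta t.
  by apply: internal_variable_ge0 etasol eta0 t0 below => // r; exact: sqr_ge0.
have ceta : eta r @[r --> t^'+] --> eta t.
  exact: abs_continuous_cvg_right (etasol.1 _ t1) t0 tt1.
have cy : y r @[r --> t^'+] --> y t.
  exact: abs_continuous_cvg_right (ysol.1 _ t1) t0 tt1.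
have cthr : c * (eta r + w) / W @[r --> t^'+] --> c * (eta t + w) / W.
  apply: cvgMl; apply: cvgMr; apply: cvgD => //; exact: cvg_cst.
have thr := event_threshold rule tek tek1 cthr cy.
have lip := solves_derive_bounded_fnorm_le M0 ysol yM s0 st below.
have sqrt_le : Num.sqrt (c * w / W) <= M * (t - s).
  apply: le_trans lip; rewrite -[leRHS](ger0_norm (sqrtr_ge0 _)) -sqrtr_sqr.
  apply: ler_wsqrtr; apply: le_trans thr.
  by rewrite ler_pM2r ?invr_gt0// ler_pM2l// lerDr.
rewrite ler_pdivrMl ?mulr_gt0//.
(* [sqrt_le] is the claim without the factor 2, which nonnegativity absorbs. *)
have : 0 <= M * (t - s) by rewrite mulr_ge0 ?subr_ge0// ltW.
lra.
Qed.

(** * Coverage of the half-line *)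

Lemma event_time_ge0 (R : realType) (te : nat -> \bar R) (k : nat) :
  te 0%N = 0%E -> (forall j, te j <= te j.+1)%E -> (0 <= te k)%E.
Proof.
by move=> te0 mono; elim: k => [|k IH]; [rewrite te0|exact: le_trans (mono k)].
Qed.

(** The intervals between events are open on the right, so coverage persists for a while. Hence the
    infimum of the uncovered times cannot itself be covered by both layers. *)
Lemma covered_right (R : realType) (te : nat -> \bar R) (s : R) :
  covered te s ->
  exists2 dt : R, 0 < dt & forall t, s <= t -> t < s + dt -> covered te t.
Proof.
move=> [k /andP[ks sk]].
have cov t : s <= t -> (t%:E < te k.+1)%E -> covered te t.
  by move=> st tk; exists k; rewrite tk andbT (le_trans ks).
case E : (te k.+1) sk => [r| |//]; last first.
  by move=> _; exists 1 => // t st _; apply: cov => //; rewrite E ltry.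
rewrite lte_fin => sr; exists (r - s); first by rewrite subr_gt0.
by move=> t st tr; apply: cov => //; rewrite E lte_fin; lra.
Qed.

(* Otherwise all the event times lie below [t], although consecutive ones are
   at least [g] apart. *)
Lemma covered_of_gap (R : realType) (te : nat -> \bar R) (g t : R) :
  0 < g -> 0 <= t -> te 0%N = 0%E -> (forall k, te k <= te k.+1)%E ->
  (forall k r s, te k = r%:E -> te k.+1 = s%:E -> s <= t -> g <= s - r) ->
  covered te t.
Proof.
move=> g0 t0 te0 mono gap; apply: contrapT => ncov.
have bounded k : exists2 s, te k = s%:E & k%:R * g <= s <= t.
  elim: k => [|k [r tek /andP[kr rt]]].
    by exists 0; rewrite ?te0// mul0r lexx.
  have tek1 : (te k.+1 <= t%:E)%E.
    rewrite leNgt; apply/negP => tk; apply: ncov; exists k.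
    by rewrite tk andbT tek lee_fin.
  have := mono k; rewrite tek.
  case E : (te k.+1) tek1 => [s| |//] //; rewrite !lee_fin => st rs.
  exists s => //; rewrite st andbT -natr1 mulrDl mul1r.
  by have := gap k r s tek E st; lra.
have [s _ /andP[]] := bounded (Num.truncn (t / g)).+1.
move=> /le_trans/[apply]; rewrite leNgt => /negP; apply.
by rewrite -ltr_pdivrMr// truncnS_gt.
Qed.

(* At the first uncovered time one of the two layers would violate
   [covered_of_gap]. *)
Lemma covered_both (R : realType) (tx tz : nat -> \bar R) (gx gz : R) :
  0 < gx -> 0 < gz -> tx 0%N = 0%E -> tz 0%N = 0%E ->
  (forall k, tx k <= tx k.+1)%E -> (forall k, tz k <= tz k.+1)%E ->
  (forall k r s, tx k = r%:E -> tx k.+1 = s%:E ->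
     (forall q, 0 <= q < s -> (covered tx `&` covered tz) q) -> gx <= s - r) ->
  (forall k r s, tz k = r%:E -> tz k.+1 = s%:E ->
     (forall q, 0 <= q < s -> (covered tx `&` covered tz) q) -> gz <= s - r) ->
  forall t, 0 <= t -> (covered tx `&` covered tz) t.
Proof.
move=> gx0 gz0 tx0 tz0 monox monoz gapx gapz t t0; apply: contrapT => ncov.
pose S := [set r | 0 <= r /\ ~ (covered tx `&` covered tz) r].
have St : S t by [].
have Slb : has_lbound S by exists 0 => r [].
have Sinf : has_inf S by split=> //; exists t.
have m0 : 0 <= inf S by apply: lb_le_inf; [exists t|move=> r []].
have below q : 0 <= q < inf S -> (covered tx `&` covered tz) q.
  move=> /andP[q0 qm]; apply: contrapT => nq.
  by have := ge_inf Slb (conj q0 nq : S q); rewrite leNgt qm.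
have belowW s q : s <= inf S -> 0 <= q < s -> (covered tx `&` covered tz) q.
  by move=> sm /andP[q0 qs]; apply: below; rewrite q0 (lt_le_trans qs).
have [dx dx0 covx] : exists2 dt : R, 0 < dt &
    forall q, inf S <= q -> q < inf S + dt -> covered tx q.
  apply: covered_right; apply: (covered_of_gap gx0) => // k r s tk tk1 sm.
  by apply: (gapx k) => // q; exact: belowW.
have [dz dz0 covz] : exists2 dt : R, 0 < dt &
    forall q, inf S <= q -> q < inf S + dt -> covered tz q.
  apply: covered_right; apply: (covered_of_gap gz0) => // k r s tk tk1 sm.
  by apply: (gapz k) => // q; exact: belowW.
(* Some uncovered time lies this close to [inf S], where both layers are covered. *)
have dt0 : 0 < Num.min dx dz by rewrite lt_min dx0.
have [q [q0 nq] qm] := inf_adherent dt0 Sinf.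
have mq : inf S <= q by exact: ge_inf.
apply: nq; split.
- by apply: covx => //; apply: (lt_le_trans qm); rewrite lerD2l ge_min lexx.
- by apply: covz => //; apply: (lt_le_trans qm); rewrite lerD2l ge_min lexx orbT.
Qed.

(** * Consequences of a uniform gap, and the theorem *)

(** An event of index [k] that occurs does so no earlier than [k * g], so only finitely many indices
    fall below [b]. *)
Lemma gap_not_zeno (R : realType) (te : nat -> \bar R) (g : R) :
  0 < g -> te 0%N = 0%E -> (forall k, te k <= te k.+1)%E ->
  (forall k r s, te k = r%:E -> te k.+1 = s%:E -> g <= s - r) ->
  ~ zeno te.
Proof.
move=> g0 te0 mono gap [a [b]]; apply.
have lin k s : te k = s%:E -> k%:R * g <= s.
  elim: k s => [|k IH] s tek; first by move: tek; rewrite te0 mul0r => -[->].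
  have := mono k; have := event_time_ge0 k te0 mono; rewrite tek.
  case E : (te k) => [r| |//] // _ _.
  by rewrite -natr1 mulrDl mul1r; have := IH r E; have := gap k r s E tek; lra.
apply: sub_finite_set (finite_II (Num.truncn (b / g)).+1) => k /= /andP[_].
have := event_time_ge0 k te0 mono.
case E : (te k) => [s| |//] // _; rewrite lee_fin => sb.
rewrite ltnNge; apply/negP => bk.
have := le_trans (lin k s E) sb; rewrite leNgt => /negP; apply.
rewrite -ltr_pdivrMr//; apply: (lt_le_trans (truncnS_gt _)).
by rewrite ler_nat.
Qed.

Lemma gap_le_min_inter_event (R : realType) (te : nat -> \bar R) (g : R) :
  (forall k, te k <= te k.+1)%E ->
  (forall k r s, te k = r%:E -> te k.+1 = s%:E -> g <= s - r) ->
  (g%:E <= min_inter_event te)%E.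
Proof.
move=> mono gap; apply: le_ereal_inf_tmp => _ [k /= + <-].
have := mono k; case E : (te k) => [r| |//] // + _.
(* If the next event does not occur, the difference is [+oo]. *)
case E1 : (te k.+1) => [s| |//] // _; last by rewrite leey.
by rewrite -EFinB lee_fin; exact: gap E1.
Qed.

Theorem theorem2 (R : realType) (N : nat)
  (* communication graph, pinning gains, system matrices *)
  (adj : rel 'I_N) (b : 'I_N -> bool)
  (adj_sym : symmetric adj) (adj_irr : irreflexive adj)
  (adj_conn : forall i j, connect adj i j) (b_pinned : exists i, b i)
  (A Bdiag H K G Px Pz Qx Qz : 'M[R]_N) (B D : 'cV[R]_N)
  (Bdiag_def : Bdiag = diag_mx (\row_i (b i)%:R))
  (A_def : A = - (laplacian R adj + Bdiag))
  (B_def : B = Bdiag *m const_mx 1)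
  (H_hurwitz : hurwitz H) (K_hurwitz : hurwitz K) (G_hurwitz : hurwitz G)
  (Px_pos : posdefmx Px) (Pz_pos : posdefmx Pz)
  (Qx_def : Qx = - (Px *m A + A^T *m Px))
  (Qz_def : Qz = - (Pz *m H + H^T *m Pz))
  (Qx_pos : posdefmx Qx) (Qz_pos : posdefmx Qz)
  (KG : K^T *m Px = Pz *m G) (D_def : D = G *m const_mx 1)
  (* design parameters *)
  (beta c1 c2 c3 sigma1 sigma2 mu eps Omega Dbar : R)
  (beta_gt0 : 0 < beta) (c1_gt0 : 0 < c1) (c2_gt0 : 0 < c2) (c3_gt0 : 0 < c3)
  (c3c1_lt : c3 + c1 * beta < lambda_min Qx)
  (c2_lt : c2 * beta < lambda_min Qz)
  (sigma1_gt0 : 0 < sigma1) (sigma2_gt0 : 0 < sigma2) (mu_gt0 : 0 < mu)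
  (Dbar_gt0 : 0 < Dbar) (eps_gt0 : 0 < eps)
  (eps_gt : fnorm Px ^+ 2 / c3 * Dbar ^+ 2 < eps)
  (Omega_def : Omega = eps - fnorm Px ^+ 2 / c3 * Dbar ^+ 2)
  (Omega_gt0 : 0 < Omega)
  (* attack *)
  (d : 'cV[R]_N -> R -> 'cV[R]_N)
  (d_bounded : forall y t, 0 <= t -> fnorm (d y t) <= Dbar)
  (* trajectory, held samples, internal variables, event times *)
  (x0 : R) (x z xbar zbar : R -> 'cV[R]_N) (eta nu : R -> R) (eta0 nu0 : R)
  (tx tz : nat -> \bar R)
  (xbar_hold : is_hold tx x xbar) (zbar_hold : is_hold tz z zbar)
  (x_dyn : solves_on (covered tx `&` covered tz) x
    (fun t => A *m x t + beta *: (K *m zbar t) + x0 *: B + d (x t) t))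
  (z_dyn : solves_on (covered tx `&` covered tz) z
    (fun t => H *m z t - beta *: (G *m xbar t) + (beta * x0) *: D))
  (eta_dyn : solves_on (covered tx `&` covered tz) eta
    (fun t => - eta t + sigma1 * fnorm (x t - xbar t) ^+ 2))
  (nu_dyn : solves_on (covered tx `&` covered tz) nu
    (fun t => - nu t + sigma2 * fnorm (z t - zbar t) ^+ 2))
  (eta_init : eta 0 = eta0) (eta0_ge0 : 0 <= eta0)
  (nu_init : nu 0 = nu0) (nu0_ge0 : 0 <= nu0)
  (tx_rule : event_rule tx x (fun t =>
    c2 * (eta t + Omega) / (beta * fnorm (Pz *m G) ^+ 2 + sigma1 * c2)))
  (tz_rule : event_rule tz z (fun t =>
    c1 * (nu t + mu) / (beta * fnorm (Px *m K) ^+ 2 + sigma2 * c1)))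
  (* bounded state derivatives *)
  (Mx Mz : R) (Mx_gt0 : 0 < Mx) (Mz_gt0 : 0 < Mz)
  (x_bound : derive_bounded_on (covered tx `&` covered tz) x Mx)
  (z_bound : derive_bounded_on (covered tx `&` covered tz) z Mz) :
  let boundx : R := (2 * Mx)^-1 * Num.sqrt
    (c2 * Omega / (beta * fnorm (Pz *m G) ^+ 2 + sigma1 * c2)) in
  let boundz : R := (2 * Mz)^-1 * Num.sqrt
    (c1 * mu / (beta * fnorm (Px *m K) ^+ 2 + sigma2 * c1)) in
  [/\ ~ zeno tx, ~ zeno tz,
      (boundx%:E <= min_inter_event tx)%E /\ 0 < boundx &
      (boundz%:E <= min_inter_event tz)%E /\ 0 < boundz].
Proof.
move=> boundx boundz.
have Wx : 0 < beta * fnorm (Pz *m G) ^+ 2 + sigma1 * c2.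
  by rewrite ltr_wpDl ?mulr_gt0// mulr_ge0 ?sqr_ge0// ltW.
have Wz : 0 < beta * fnorm (Px *m K) ^+ 2 + sigma2 * c1.
  by rewrite ltr_wpDl ?mulr_gt0// mulr_ge0 ?sqr_ge0// ltW.
have bx0 : 0 < boundx.
  by rewrite mulr_gt0 ?invr_gt0 ?sqrtr_gt0 ?mulr_gt0 ?invr_gt0.
have bz0 : 0 < boundz.
  by rewrite mulr_gt0 ?invr_gt0 ?sqrtr_gt0 ?mulr_gt0 ?invr_gt0.
have tx0 : tx 0%N = 0%E by case: tx_rule.
have tz0 : tz 0%N = 0%E by case: tz_rule.
have monox k : (tx k <= tx k.+1)%E by exact: event_rule_le tx_rule.
have monoz k : (tz k <= tz k.+1)%E by exact: event_rule_le tz_rule.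
have gapx k r s : tx k = r%:E -> tx k.+1 = s%:E ->
    (forall q, 0 <= q < s -> (covered tx `&` covered tz) q) ->
    boundx <= s - r.
  move=> tk tk1; apply: (layer_gap c2_gt0 Omega_gt0 Wx Mx_gt0 (ltW sigma1_gt0)
    x_dyn x_bound eta_dyn _ tx_rule tk tk1); first by rewrite eta_init.
  by have := event_time_ge0 k tx0 monox; rewrite tk.
have gapz k r s : tz k = r%:E -> tz k.+1 = s%:E ->
    (forall q, 0 <= q < s -> (covered tx `&` covered tz) q) ->
    boundz <= s - r.
  move=> tk tk1; apply: (layer_gap c1_gt0 mu_gt0 Wz Mz_gt0 (ltW sigma2_gt0)
    z_dyn z_bound nu_dyn _ tz_rule tk tk1); first by rewrite nu_init.
  by have := event_time_ge0 k tz0 monoz; rewrite tk.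
(* The gaps so far presuppose coverage of the past; coverage of all nonnegative times now removes
   that premise. *)
have cov := covered_both bx0 bz0 tx0 tz0 monox monoz gapx gapz.
have {}gapx k r s : tx k = r%:E -> tx k.+1 = s%:E -> boundx <= s - r.
  by move=> tk tk1; apply: (gapx k) => // q /andP[q0 _]; exact: cov.
have {}gapz k r s : tz k = r%:E -> tz k.+1 = s%:E -> boundz <= s - r.
  by move=> tk tk1; apply: (gapz k) => // q /andP[q0 _]; exact: cov.
split; [exact: gap_not_zeno gapx|exact: gap_not_zeno gapz|split|split] => //.
- exact: gap_le_min_inter_event.
- exact: gap_le_min_inter_event.
Qed.
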